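(* Let $n\ge 1$ and $1\le d\le n$ be integers, let $G:\mathbb{R}^n\to\mathbb{R}^+$ be a function which is convex with respect to each variable separately, and let $\phi=\{\phi_k:\ k=1,2,\ldots,n\}$ be a system of random variables satisfying $\|\phi_k\|_\infty\le 1$ for all $k$. Then there exist $d$-independent Rademacher random variables $r_1,\ldots,r_n$ such that $$\mathbf{E}\left[G(\phi_1,\ldots,\phi_n)\right]\le (1+\mu_d(\phi))\,\mathbf{E}\left[G(r_1,\ldots,r_n)\right].$$
   Context: $\mathbb{R}^+$ denotes the nonnegative reals. A Rademacher random variable takes the values $\pm1$ with probability $1/2$ each. A system of random variables is called $d$-independent if any collection of $d$ of its elements is independent. Here (bounds $A_k=-1$, $B_k=1$) the $d$-multiplicative error of $\phi$ is $$\mu_d(\phi)=\sum_{\emptyset\ne A\subset\{1,\ldots,n\},\ \#(A)\le d}\left|\mathbf{E}\Big[\prod_{j\in A}\phi_j\Big]\right|.$$ The random variables $r_k$ need not live on the same probability space as the $\phi_k$. *)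

(* Defs.v *)
From HB Require Import structures.
From mathcomp Require Import all_boot all_order all_algebra.
From mathcomp Require Import all_classical all_reals all_analysis.

Set Implicit Arguments.
Unset Strict Implicit.
Unset Printing Implicit Defensive.

Import Order.TTheory GRing.Theory Num.Theory.
Import numFieldNormedType.Exports.

Local Open Scope classical_set_scope.
Local Open Scope ring_scope.

Definition set_coord (R : realType) (n : nat)
    (x : 'rV[R]_n) (k : 'I_n) (t : R) : 'rV[R]_n :=
  \row_(j < n) (if j == k then t else x 0 j).

Definition separately_convex (R : realType) (n : nat) (G : 'rV[R]_n -> R) :=
  forall (k : 'I_n) (x : 'rV[R]_n),
    convex_function [set: R^o] (fun t : R^o => G (set_coord x k t)).

Definition independent_on (disp : measure_display) (T : measurableType disp)
    (R : realType) (P : probability T R) (I : finType)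
    (X : I -> {RV P >-> R}) (A : {set I}) : Prop :=
  forall J : {set I}, J \subset A ->
  forall B : I -> set R, (forall i, i \in J -> measurable (B i)) ->
    (P (\bigcap_(i in [set` J]) (X i @^-1` B i))
     = \prod_(i in J) P (X i @^-1` B i))%E.

Definition d_independent (disp : measure_display) (T : measurableType disp)
    (R : realType) (P : probability T R) (I : finType) (d : nat)
    (X : I -> {RV P >-> R}) : Prop :=
  forall A : {set I}, #|A| = d -> independent_on X A.

Definition rademacher (disp : measure_display) (T : measurableType disp)
    (R : realType) (P : probability T R) (X : {RV P >-> R}) : Prop :=
  P (X @^-1` [set 1]) = (2^-1)%:E /\ P (X @^-1` [set -1]) = (2^-1)%:E.

(* The d-multiplicative error for the bounds A_k = -1 and B_k = 1. *)
Definition multiplicative_error (disp : measure_display)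
    (T : measurableType disp) (R : realType) (P : probability T R) (n d : nat)
    (phi : 'I_n -> {RV P >-> R}) : \bar R :=
  (\sum_(A : {set 'I_n} | (A != finset.set0) && (#|A| <= d)%N)
     `| 'E_P[(fun w : T => \prod_(j in A) phi j w)%R] |)%E.

(* Main.v *)
(* By convexity in each variable, on the cube [-1, 1]^n the function G is
   bounded by its multilinear interpolation
     \sum_s (\prod_k (1 + s_k x_k) / 2) G(s)
   over the vertices s.  Taking expectations bounds E[G(phi)] by
   \sum_s q(s) G(s), where q(s) = 2^-n \sum_A c_A w_A(s), with c_A the
   expectation of \prod_(j in A) phi_j and w_A(s) = \prod_(j in A) s_j the
   Walsh functions.  Adding 2^-n \sum_A (|c_A| - c_A w_A(s)) >= 0, over the A
   with 0 < |A| <= d, erases the coefficients of order 1, ..., d and adds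
   mu_d(phi) to the constant one.  The result is (1 + mu_d(phi)) p(s) for a
   probability p on {-1, 1}^n whose coordinates are d-independent Rademacher
   variables, because all their correlations of order 1, ..., d vanish. *)
Require Import Defs.
From HB Require Import structures.
From mathcomp Require Import all_boot all_order all_algebra.
From mathcomp Require Import all_classical all_reals all_analysis.
From mathcomp Require Import measurable_realfun ess_sup_inf lra.

Set Implicit Arguments.
Unset Strict Implicit.
Unset Printing Implicit Defensive.

Import Order.TTheory GRing.Theory Num.Theory.
Import numFieldNormedType.Exports.

Local Open Scope classical_set_scope.
Local Open Scope ring_scope.

(** * Walsh functions on the vertices of the cube *)

Section walsh.
Variables (R : realFieldType) (I : finType).
Implicit Types (A K S : {set I}) (i : I).

(** A subset [S] encodes the vertex of the cube with coordinate 1 on [S] and -1 off it. *)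
Definition sign S i : R := if i \in S then 1 else -1.

Definition walsh A S : R := \prod_(i in A) sign S i.

Lemma walsh0 S : walsh finset.set0 S = 1.
Proof. exact: big_set0. Qed.

Lemma normr_sign S i : `|sign S i| = 1.
Proof. by rewrite /sign; case: ifP; rewrite ?normrN normr1. Qed.

Lemma normr_walsh A S : `|walsh A S| = 1.
Proof. by rewrite normr_prod big1// => i _; rewrite normr_sign. Qed.

Lemma sign_weight_ge0 (t : R) S i : `|t| <= 1 -> 0 <= (1 + sign S i * t) / 2.
Proof. by rewrite ler_norml /sign => /andP[? ?]; case: ifP => _; lra. Qed.

Lemma prod_add_sign (a b : I -> R) S :
  \prod_i (a i + b i * sign S i) =
  \sum_(A : {set I}) \prod_(i in A) b i * \prod_(i in ~: A) a i * walsh A S.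
Proof.
under eq_bigr do rewrite addrC.
rewrite bigA_distr; apply: eq_bigr => A _.
rewrite (bigID (mem A))/= [RHS]mulrAC -big_split/=; congr (_ * _).
  by apply: eq_bigr => i ->.
by apply: eq_big => [i|i /negPf ->]; rewrite ?inE.
Qed.

(** The sum over [S] factors over the coordinates, and a coordinate in exactly one of [A] and [K]
    contributes [1 - 1]. *)
Lemma sum_walshM A K : A != K -> \sum_S walsh A S * walsh K S = 0.
Proof.
move=> AK; pose s (B : {set I}) i : R := if i \in B then -1 else 1.
have walshE B S : walsh B S = \prod_i if i \in S then 1 else s B i.
  rewrite /walsh big_mkcond; apply: eq_bigr => i _.
  by rewrite /sign /s; case: (i \in B); case: (i \in S).
under eq_bigr do rewrite !walshE -big_split/=.
have [i Hi] : exists i, (i \in A) != (i \in K).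
  apply/existsP; apply: contraNT AK; rewrite negb_exists => /forallP AK.
  by apply/eqP/setP => i; apply/eqP; rewrite -[_ == _]negbK.
transitivity (\prod_i (1 + s A i * s K i)).
  rewrite bigA_distr; apply: eq_bigr => S _; apply: eq_bigr => j _.
  by case: ifP; rewrite ?mulr1.
apply/eqP/prodf_eq0; exists i => //.
by move: Hi; rewrite /s; do 2 case: ifP; rewrite // ?(mulr1, mul1r) subrr.
Qed.

Lemma sum_walsh A :
  \sum_S walsh A S = if A == finset.set0 then 2 ^+ #|I| else 0.
Proof.
have [->|A0] := eqVneq.
  under eq_bigr do rewrite walsh0.
  by rewrite sumr_const -natrX -[#|I|]cardsT -card_powerset powersetT cardsT.
by rewrite -[RHS](sum_walshM A0); under [RHS]eq_bigr do rewrite walsh0 mulr1.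
Qed.

(** The left side is the weight of the vertex [S] in the multilinear interpolation at [x]; its Walsh
    form exposes the products whose expectations are the correlations. *)
Lemma expand_sign_weight (x : I -> R) S :
  \prod_i ((1 + sign S i * x i) / 2) =
  2 ^- #|I| * \sum_(A : {set I}) (\prod_(i in A) x i) * walsh A S.
Proof.
rewrite big_split/= prodr_const -exprVn mulrC; congr (_ * _).
under eq_bigr do rewrite mulrC.
rewrite prod_add_sign; apply: eq_bigr => A _.
by rewrite big1_eq mulr1.
Qed.

Lemma sum_sign_weight (x : I -> R) :
  \sum_(S : {set I}) \prod_i ((1 + sign S i * x i) / 2) = 1.
Proof.
under eq_bigr do rewrite expand_sign_weight.
rewrite -mulr_sumr exchange_big/= (bigD1 finset.set0)//= [X in _ + X]big1.
  by rewrite -mulr_sumr sum_walsh eqxx big_set0 mul1r addr0 mulVf// expf_neq0.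
by move=> A A0; rewrite -mulr_sumr sum_walsh (negPf A0) mulr0.
Qed.

(* Adding [`|c A| - c A * walsh A S >= 0] for every nonempty [A] of size at most
   [d] cancels the correlations of order at most [d]. *)
Lemma cancel_low_correlations (c : {set I} -> R) (d : nat) :
  c finset.set0 = 1 -> (forall S, 0 <= \sum_A c A * walsh A S) ->
  exists p : {set I} -> R,
    [/\ forall S, 0 <= p S,
        forall K, (#|K| <= d)%N ->
          \sum_S p S * walsh K S = (K == finset.set0)%:R
      & forall S, 2 ^- #|I| * \sum_A c A * walsh A S <=
          (1 + \sum_(A : {set I} | (A != finset.set0) && (#|A| <= d)%N) `|c A|)
          * p S].
Proof.
move=> c0 q0; set M := 1 + _.
have M1 : 1 <= M by rewrite lerDl sumr_ge0.
have M0 : 0 < M by exact: lt_le_trans M1.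
pose high S : R := \sum_(A : {set I} | (d < #|A|)%N) c A * walsh A S.
(* Bounding the terms of order 1 to [d] by [|c A|] leaves [M + high S]; division by [M] makes the
   total mass 1. *)
pose p S := 2 ^- #|I| * (1 + M^-1 * high S).
have pow2 : 0 < 2 ^- #|I| :> R by rewrite invr_gt0 exprn_gt0.
have qM S : 2 ^- #|I| * (\sum_A c A * walsh A S) <= M * p S.
  rewrite /p [leRHS]mulrCA ler_pM2l// mulrDr mulr1 mulrA divff ?gt_eqF// mul1r.
  rewrite (bigID (fun A : {set I} => (d < #|A|)%N))/= addrC lerD2r.
  rewrite (bigD1 finset.set0) ?cards0//= c0 walsh0 mulr1 lerD2l.
  under [leLHS]eq_bigl do rewrite -leqNgt andbC.
  apply: ler_sum => A _; rewrite (le_trans (ler_norm _))// normrM.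
  by rewrite normr_walsh mulr1.
exists p; split => // [S|K Kd].
  by rewrite -(pmulr_rge0 _ M0) (le_trans _ (qM S))// mulr_ge0// ltW.
rewrite /p; under eq_bigr do rewrite -mulrA mulrDl mul1r -mulrA.
rewrite -mulr_sumr big_split/= -mulr_sumr sum_walsh.
have -> : \sum_S high S * walsh K S = 0.
  under eq_bigr do rewrite /high mulr_suml.
  rewrite exchange_big/= big1// => A Ad.
  under eq_bigr do rewrite -mulrA.
  rewrite -mulr_sumr sum_walshM ?mulr0//.
  by apply: contraTneq Ad => ->; rewrite -leqNgt.
rewrite mulr0 addr0; case: eqP => _; last by rewrite mulr0.
by rewrite mulVf// expf_neq0.
Qed.

(** Expanding the product yields only Walsh functions of subsets of [J]; these have order at most
    [d], so only the constant term survives. *)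
Lemma sum_prod_affine_sign (p : {set I} -> R) (d : nat)
    (p_walsh : forall K, (#|K| <= d)%N ->
      \sum_S p S * walsh K S = (K == finset.set0)%:R)
    (a b : I -> R) (J : {set I}) : (#|J| <= d)%N ->
  \sum_S p S * \prod_(i in J) (a i + b i * sign S i) = \prod_(i in J) a i.
Proof.
move=> Jd.
(* Padding by 1 and 0 off [J] makes the product run over all of [I] and kills every [K] not inside
   [J]. *)
pose a' i := if i \in J then a i else 1.
pose b' i := if i \in J then b i else 0.
transitivity (\sum_S p S * \prod_i (a' i + b' i * sign S i)).
  apply: eq_bigr => S _; congr (_ * _); rewrite big_mkcond.
  apply: eq_bigr => i _; rewrite /a' /b'.
  by case: ifP; rewrite ?mul0r ?addr0.
under [LHS]eq_bigr do rewrite prod_add_sign mulr_sumr.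
rewrite exchange_big/= (bigD1 finset.set0)//= [X in _ + X]big1 ?addr0.
  under eq_bigr do rewrite mulrCA.
  rewrite -mulr_sumr p_walsh ?cards0// eqxx mulr1 big_set0 mul1r.
  rewrite finset.setC0 big_mkcond [RHS]big_mkcond.
  by apply: eq_bigr => i _; rewrite inE.
move=> K K0; under eq_bigr do rewrite mulrCA.
rewrite -mulr_sumr; have [KJ|/subsetPn[i iK iJ]] := boolP (K \subset J).
  by rewrite p_walsh ?(negPf K0) ?mulr0// (leq_trans (subset_leq_card KJ)).
by rewrite (bigD1 i)//= {1}/b' (negPf iJ) !mul0r.
Qed.

End walsh.

(** * Convexity and multilinear interpolation on the cube *)

Section separate_convexity.
Variables (R : realType) (n : nat) (G : 'rV[R]_n -> R).
Hypothesis G_convex : separately_convex G.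

(** A point [t] of [-1, 1] is the average of 1 and -1 with weights [(1 + t) / 2] and
    [(1 - t) / 2]. *)
Lemma separately_convex_le_endpoints (x : 'rV[R]_n) (k : 'I_n) :
  `|x 0 k| <= 1 ->
  G x <= (1 + x 0 k) / 2 * G (set_coord x k 1) +
         (1 - x 0 k) / 2 * G (set_coord x k (-1)).
Proof.
move=> xk1; have /andP[xk_ge xk_le] : -1 <= x 0 k <= 1 by rewrite -ler_norml.
have t0 : 0 <= (1 + x 0 k) / 2 by lra.
have t1 : (1 + x 0 k) / 2 <= 1 by lra.
have := @G_convex k x (Itv01 t0 t1) 1 (-1).
rewrite !inE => /(_ I I).
rewrite !convRE /= /unstable.onem.
have -> : 1 - (1 + x 0 k) / 2 = (1 - x 0 k) / 2 by lra.
set y := set_coord x k _; suff -> : y = x by [].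
apply/rowP => j; rewrite mxE; case: eqP => // ->.
transitivity ((1 + x 0 k) / 2 * 1 + (1 - (1 + x 0 k) / 2) * (-1)); first by [].
lra.
Qed.

Lemma separately_convex_le_vertices (x : 'rV[R]_n) :
  (forall k, `|x 0 k| <= 1) ->
  G x <= \sum_(S : {set 'I_n})
    \prod_k ((1 + sign R S k * x 0 k) / 2) * G (\row_k sign R S k).
Proof.
move=> x1; pose w (S : {set 'I_n}) := \prod_k ((1 + sign R S k * x 0 k) / 2).
(* [y D S] agrees with the vertex [S] on [D] and with [x] elsewhere; [D] grows one coordinate at a
   time from the empty set, where every term carries [G x], to the full set. *)
pose y (D S : {set 'I_n}) : 'rV[R]_n :=
  \row_k if k \in D then sign R S k else x 0 k.
have step (D : {set 'I_n}) k : k \notin D ->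
    \sum_S w S * G (y D S) <= \sum_S w S * G (y (k |: D) S).
  move=> kD.
  (* Vertices are paired as [S] and [k |: S], which differ only in the coordinate [k]. *)
  have split_k (f : {set 'I_n} -> R) :
      \sum_S f S = \sum_(S : {set 'I_n} | k \notin S) (f S + f (k |: S)).
    rewrite (bigID (fun S : {set 'I_n} => k \in S))/= addrC big_split/=.
    congr (_ + _).
    rewrite (reindex_onto (fun S => k |: S) (fun S => S :\ k))/=; last first.
      by move=> S kS; rewrite finset.setD1K.
    apply: eq_bigl => S; rewrite setU11/=; have [kS|kS] := boolP (k \in S).
      by apply/eqP => /setP/(_ k); rewrite !inE eqxx kS.
    by rewrite setU1K ?eqxx.
  rewrite !split_k; apply: ler_sum => S kS.
  pose w' := \prod_(j | j != k) ((1 + sign R S j * x 0 j) / 2).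
  have w'0 : 0 <= w'.
    by apply: prodr_ge0 => j _; exact: sign_weight_ge0.
  have wS : w S = (1 - x 0 k) / 2 * w'.
    by rewrite /w (bigD1 k)//= {1}/sign (negPf kS) mulN1r.
  have wkS : w (k |: S) = (1 + x 0 k) / 2 * w'.
    rewrite /w (bigD1 k)//= {1}/sign setU11 mul1r; congr (_ * _).
    by apply: eq_bigr => j /negPf jk; rewrite /sign !inE jk.
  have yk : y D (k |: S) = y D S.
    apply/rowP => j; rewrite !mxE; case: ifP => // jD; rewrite /sign !inE.
    by case: eqP jD kD => // -> ->.
  have yS : y (k |: D) S = set_coord (y D S) k (-1).
    apply/rowP => j; rewrite !mxE !inE; case: eqP => //= ->.
    by rewrite /sign (negPf kS).
  have ykS : y (k |: D) (k |: S) = set_coord (y D S) k 1.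
    apply/rowP => j; rewrite !mxE !inE /sign; case: eqP => [->|/eqP/negPf jk]/=.
      by rewrite setU11.
    by rewrite !inE jk.
  rewrite yk yS ykS wS wkS.
  have := @separately_convex_le_endpoints (y D S) k.
  rewrite mxE (negPf kD) => /(_ (x1 k)) /(ler_wpM2l w'0).
  lra.
have sub (D : {set 'I_n}) : G x <= \sum_S w S * G (y D S).
  elim: {D}#|D| {-2}D (erefl #|D|) => [D /eqP|m IH D Dm].
    rewrite cards_eq0 => /eqP ->; rewrite (eq_bigr (fun S => w S * G x)).
      by rewrite -mulr_suml sum_sign_weight mul1r.
    move=> S _; congr (_ * G _).
    by apply/rowP => j; rewrite mxE inE.
  have [k kD] : exists k, k \in D by apply/set0Pn; rewrite -card_gt0 Dm.
  rewrite (le_trans (IH (D :\ k) _))//.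
    by move: Dm; rewrite (cardsD1 k) kD => -[].
  by rewrite -{2}(finset.setD1K kD) step// !inE eqxx.
rewrite (le_trans (sub [set: _]%SET))// le_eqVlt; apply/orP; left; apply/eqP.
apply: eq_bigr => S _; congr (_ * G _).
by apply/rowP => j; rewrite !mxE inE.
Qed.

End separate_convexity.

(** * Integrals and finite laws *)

(* Replaces [ae_ge0_le_integral], which requires [f] measurable: nothing is known
   about the measurability of [G] composed with [phi]. *)
Lemma le_integral_dominating d (T : measurableType d) (R : realType)
    (mu : {measure set T -> \bar R}) (f h : T -> \bar R) :
  (forall x, 0 <= f x)%E -> measurable_fun [set: T] h ->
  (forall x, 0 <= h x)%E -> {ae mu, forall x, (f x <= h x)%E} ->
  (\int[mu]_x f x <= \int[mu]_x h x)%E.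
Proof.
move=> f0 mh h0 [N [mN N0 fhN]].
(* The added function is infinite on the null set [N] and has integral zero; with it [f] is
   dominated everywhere. *)
have mN' : measurable_fun [set: T] (fun x => +oo * (\1_N x)%:E : \bar R)%E.
  by apply: emeasurable_funM => //; exact/measurable_EFinP.
have N'0 x : (0 <= +oo * (\1_N x)%:E :> \bar R)%E by rewrite mule_ge0// lee_fin.
rewrite [leRHS](_ : _ = \int[mu]_x (h x + +oo * (\1_N x)%:E))%E; last first.
  rewrite ge0_integralD// ge0_integralZl//; last exact/measurable_EFinP.
  by rewrite integral_indic// setIT N0 mule0 adde0.
(* As suprema over simple functions below the integrand, the two integrals compare without
   measurability of [f]. *)
rewrite !ge0_integralTE//; last by move=> x; rewrite adde_ge0.
apply: ereal_sup_le => _ [g /= gf <-].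
exists g => // x; rewrite (le_trans (gf x))//.
have [xN|xN] := boolP (x \in N).
  by rewrite indicE xN mule1 addey ?leey// gt_eqF// (lt_le_trans _ (h0 x)).
rewrite indicE (negPf xN) mule0 adde0; apply: contrapT => fh.
by move/negP: xN; apply; rewrite inE; apply: fhN => /=.
Qed.

(** The measure is a sum of weighted Dirac masses at the indices of an enumeration of [T]; on [nat]
    every function is measurable. *)
Lemma finite_probability (R : realType) (T : finType) (p : T -> R) :
  (forall x, 0 <= p x) -> \sum_x p x = 1 ->
  exists (P : probability nat R) (X : nat -> T), forall f : T -> \bar R,
    (forall x, 0 <= f x)%E ->
    (\int[P]_w f (X w) = \sum_x (p x)%:E * f x)%E.
Proof.
move=> p0 p1.
(* Total mass 1 forces [T] to be inhabited; [x0] is the default of [nth] at indices carrying no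
   mass. *)
have [x0 _] : exists x0 : T, true.
  apply: contrapT => noT; move: p1; rewrite big1 => [/esym/eqP|x].
    by rewrite oner_eq0.
  by exfalso; apply: noT; exists x.
pose X := nth x0 (enum T).
pose m i : {measure set nat -> \bar R} := mscale (NngNum (p0 (X i))) \d_i.
pose mu : {measure set nat -> \bar R} := msum m #|T|.
have muE (f : T -> \bar R) : (forall x, 0 <= f x)%E ->
    (\int[mu]_w f (X w) = \sum_x (p x)%:E * f x)%E.
  move=> f0; rewrite ge0_integral_measure_sum//.
  transitivity (\sum_(i < #|T|) (p (X i))%:E * f (X i))%E.
    apply: eq_bigr => i _; rewrite ge0_integral_mscale//=.
    by rewrite integral_dirac//= diracT mul1e.
  rewrite -[RHS]big_enum (big_nth x0) -cardE big_mkord.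
  by [].
have mu1 : mu [set: nat] = 1%E.
  rewrite -[LHS]mul1e -integral_cst// (muE (cst 1%E))//.
  by under eq_bigr do rewrite mule1; rewrite sumEFin p1.
pose P : probability nat R := HB.pack (msum m #|T|)
  (Measure_isProbability.Build _ _ _ (msum m #|T|) mu1).
by exists P, X.
Qed.

Lemma integrable_normr_le1 d (T : measurableType d) (R : realType)
    (P : probability T R) (f : T -> R) :
  measurable_fun [set: T] f -> (forall w, `|f w| <= 1) ->
  P.-integrable [set: T] (EFin \o f).
Proof.
move=> mf f1; apply: measurable_bounded_integrable => //.
  by rewrite [ltLHS](@probability_setT _ _ _ P) ltry.
by exists 1; split => // M M1 w _; exact: le_trans (f1 w) (ltW M1).
Qed.

Lemma measurable_prod_set d (T : measurableType d) (R : realType)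
    (I : finType) (f : I -> T -> R) (A : {set I}) :
  (forall k, measurable_fun [set: T] (f k)) ->
  measurable_fun [set: T] (fun w => \prod_(j in A) f j w).
Proof.
by move=> mf; under eq_fun do rewrite -big_enum/=; exact: measurable_prod.
Qed.

Lemma integrable_prod_normr_le1 d (T : measurableType d) (R : realType)
    (P : probability T R) (I : finType) (f : I -> T -> R) (A : {set I}) :
  (forall k, measurable_fun [set: T] (f k)) ->
  (forall k w, `|f k w| <= 1) ->
  P.-integrable [set: T] (EFin \o (fun w => \prod_(j in A) f j w)).
Proof.
move=> mf f1; apply: integrable_normr_le1 => [|w].
  exact: measurable_prod_set.
by rewrite normr_prod prodr_ile1// => j _; rewrite normr_ge0 f1.
Qed.

Lemma integral_sign_weight d (T : measurableType d) (R : realType)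
    (P : probability T R) (I : finType) (psi : I -> T -> R) (S : {set I}) :
  (forall k, measurable_fun [set: T] (psi k)) ->
  (forall k w, `|psi k w| <= 1) ->
  (\int[P]_w (\prod_k ((1 + sign R S k * psi k w) / 2))%:E =
   (2 ^- #|I| *
    \sum_(A : {set I})
      (\int[P]_w (\prod_(j in A) psi j w)) * walsh R A S)%:E)%E.
Proof.
move=> mpsi psi1.
have int_prod (A : {set I}) :
    P.-integrable [set: T] (EFin \o (fun w => \prod_(j in A) psi j w)).
  exact: integrable_prod_normr_le1.
under eq_integral do rewrite expand_sign_weight EFinM -sumEFin.
under eq_integral do under eq_bigr do rewrite EFinM muleC.
have int_term (A : {set I}) : P.-integrable [set: T]
    (fun w => (walsh R A S)%:E * (\prod_(j in A) psi j w)%:E)%E.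
  exact: (integrableZl measurableT (walsh R A S) (int_prod A)).
rewrite integralZl//; last by apply: integrable_sum => // A _; exact: int_term.
rewrite integral_sum// EFinM -sumEFin; congr (_ * _)%E.
apply: eq_bigr => A _; rewrite integralZl//; last exact: int_prod.
rewrite muleC EFinM; congr (_ * _)%E.
rewrite /Rintegral fineK//; apply: integrable_fin_num => //; exact: int_prod.
Qed.

(** * Construction of the Rademacher variables *)

(** An indicator is affine in a sign, so the probability of a cylinder over at most [d] coordinates
    is the expectation of a product of affine functions, which factors by [sum_prod_affine_sign].
    The last clause records the joint law. *)
Lemma d_independent_rademacher (R : realType) (I : finType) (d : nat)
    (p : {set I} -> R) : (0 < d)%N -> (forall S, 0 <= p S) ->
  (forall K : {set I}, (#|K| <= d)%N ->
    \sum_S p S * walsh R K S = (K == finset.set0)%:R) ->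
  exists (P : probability nat R) (r : I -> {RV P >-> R}),
    [/\ forall k, rademacher (r k), d_independent d r
      & forall f : (I -> R) -> \bar R, (forall x, 0 <= f x)%E ->
        (\int[P]_w f (fun k => r k w) =
         \sum_(S : {set I}) (p S)%:E * f (sign R S))%E].
Proof.
move=> d0 p0 p_walsh.
have p1 : \sum_S p S = 1.
  have := p_walsh finset.set0; rewrite cards0 eqxx mulr1n => /(_ isT) <-.
  by apply: eq_bigr => S _; rewrite walsh0 mulr1.
have [P [X PX]] := finite_probability p0 p1.
have mr k : measurable_fun [set: nat] (fun w => sign R (X w) k) by [].
pose r k : {RV P >-> R} := mfun_Sub (mem_set (mr k)).
have rE k w : r k w = sign R (X w) k by [].
(* Half sum and half difference of the values of the indicator at 1 and -1: the coefficients of its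
   affine interpolation. *)
pose a (B : set R) : R := (\1_B 1 + \1_B (-1)) / 2.
pose b (B : set R) : R := (\1_B 1 - \1_B (-1)) / 2.
have indic_sign (B : set R) S k : \1_B (sign R S k) = a B + b B * sign R S k.
  by rewrite /a /b /sign; case: ifP => _; lra.
have cyl (J : {set I}) (B : I -> set R) : (#|J| <= d)%N ->
    P (\bigcap_(i in [set` J]) (r i @^-1` B i)) = (\prod_(i in J) a (B i))%:E.
  move=> Jd; rewrite -(sum_prod_affine_sign p_walsh _ (b \o B) Jd).
  rewrite -sumEFin -[X in P X]setIT -integral_indic//.
  rewrite -[RHS](PX (fun S =>
    (\prod_(i in J) (a (B i) + b (B i) * sign R S i))%:E)); last first.
    move=> S; rewrite lee_fin; apply: prodr_ge0 => i _.
    by rewrite -indic_sign.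
  apply: eq_integral => w _; congr _%:E.
  under eq_bigr do rewrite -indic_sign.
  rewrite indicE; have [BJ|] := pselect (forall i, i \in J -> B i (r i w)).
    by rewrite mem_set// big1// => i iJ; rewrite indicE mem_set//; exact: BJ.
  move=> nBJ; rewrite memNset//.
  have /existsNP[i /not_implyP[iJ nBi]] := nBJ.
  by rewrite (bigD1 i)//= indicE memNset ?mul0r.
have marg i (B : set R) : P (r i @^-1` B) = (a B)%:E.
  (* A marginal is a cylinder over one coordinate, within range because [d] is at least 1. *)
  have := cyl [set i]%SET (fun=> B); rewrite cards1 big_set1 => /(_ d0) <-.
  congr (P _); apply/seteqP; split=> [w Bw j /=|w /(_ i)].
    by rewrite inE => /eqP ->.
  by apply; rewrite /= inE.
exists P, r; split.
- move=> k; rewrite /rademacher !marg /a !indicE.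
  have neq1N1 : 1 <> -1 :> R by move=> ?; lra.
  rewrite !(@mem_set _ [set _] _ erefl) !memNset//; last by move/esym.
  by rewrite addr0 add0r mul1r.
- move=> A Ad J JA B _; rewrite cyl -?Ad ?subset_leq_card//.
  by rewrite -prodEFin; apply: eq_bigr => i _; rewrite marg.
- by move=> f f0; exact: (PX (fun S => f (sign R S))).
Qed.

(** * The expectation inequality *)

Lemma ae_normr_le1 d (T : measurableType d) (R : realType)
    (P : probability T R) (f : T -> R) :
  ('N[P]_+oo[EFin \o f] <= 1)%E -> {ae P, forall w, `|f w| <= 1}.
Proof.
(* The total mass is positive, so ['N[P]_+oo] is the essential supremum of the absolute value. *)
rewrite unlock /= [P _](@probability_setT _ _ _ P) lte01 => /ess_supP.
by apply: filterS => w; rewrite /= lee_fin.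
Qed.

Theorem corollary1p1 (R : realType) (n d : nat)
    (hn : (1 <= n)%N) (hd1 : (1 <= d)%N) (hdn : (d <= n)%N)
    (G : 'rV[R]_n -> R) (G_ge0 : forall x, 0 <= G x)
    (G_convex : separately_convex G)
    (disp : measure_display) (Omega : measurableType disp)
    (P : probability Omega R) (phi : 'I_n -> {RV P >-> R})
    (phi_le1 : forall k, ('N[P]_+oo[EFin \o phi k] <= 1)%E) :
  exists (disp' : measure_display) (Omega' : measurableType disp')
         (P' : probability Omega' R) (r : 'I_n -> {RV P' >-> R}),
    [/\ forall k, rademacher (r k),
        d_independent d r
      & ('E_P[(fun w : Omega => G (\row_(k < n) phi k w))%R]
         <= (1 + multiplicative_error d phi)
            * 'E_P'[(fun w : Omega' => G (\row_(k < n) r k w))%R])%E].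
Proof.
(* [psi] is [phi] truncated to [-1, 1]: the bound on [phi] only holds almost
   everywhere. *)
pose psi k w : R := Num.max (-1) (Num.min 1 (phi k w)).
have mpsi k : measurable_fun [set: Omega] (psi k).
  by apply: measurable_maxr => //; exact: measurable_minr.
have psi1 k w : `|psi k w| <= 1.
  by rewrite ler_norml /psi le_max lexx/= ge_max ge_min lexx andbT; lra.
have psi_phi : {ae P, forall w, forall k, psi k w = phi k w}.
  have : {ae P, forall w, forall k, `|phi k w| <= 1}.
    by apply: filter_forall => k; exact: ae_normr_le1.
  apply: filterS => w phi1 k; have := phi1 k; rewrite ler_norml => /andP[? ?].
  by rewrite /psi min_r// max_r.
pose c (A : {set 'I_n}) := (\int[P]_w (\prod_(j in A) psi j w)).
have c0 : c finset.set0 = 1.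
  rewrite /c; under eq_Rintegral do rewrite big_set0.
  by rewrite Rintegral_cst// [X in fine X](@probability_setT _ _ _ P) mulr1.
have weight_ge0 (S : {set 'I_n}) w :
    0 <= \prod_k ((1 + sign R S k * psi k w) / 2).
  by apply: prodr_ge0 => k _; exact: sign_weight_ge0.
have weightE S := integral_sign_weight P S mpsi psi1.
(* The Walsh sum at [S] is nonnegative, being a positive multiple of the expectation of a vertex
   weight. *)
have [S|p [p0 p_walsh cp]] := cancel_low_correlations d c0.
  have : (0 <= \int[P]_w (\prod_k ((1 + sign R S k * psi k w) / 2))%:E)%E.
    by apply: integral_ge0 => w _; rewrite lee_fin.
  by rewrite weightE lee_fin pmulr_rge0// invr_gt0 exprn_gt0.
have [P' [r [r_rad r_ind r_int]]] := d_independent_rademacher hd1 p0 p_walsh.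
exists _, nat, P', r; split => //.
have EG : ('E_P'[(fun w => G (\row_(k < n) r k w))%R] =
    (\sum_S (p S * G (\row_k sign R S k)))%R%:E)%E.
  rewrite unlock (r_int (fun x => (G (\row_k x k))%:E)) => [|x].
    by rewrite -sumEFin; apply: eq_bigr => S _; rewrite EFinM.
  by rewrite lee_fin.
have multE : multiplicative_error d phi =
    (\sum_(A : {set 'I_n} | (A != finset.set0) && (#|A| <= d)%N) `|c A|)%:E.
  rewrite /multiplicative_error -sumEFin; apply: eq_bigr => A _.
  rewrite unlock (ae_eq_integral (fun w => (\prod_(j in A) psi j w)%:E))//.
  - rewrite -abse_EFin /c /Rintegral fineK//; apply: integrable_fin_num => //.
    exact: integrable_prod_normr_le1.
  - by apply/measurable_EFinP; exact: measurable_prod_set.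
  - by apply/measurable_EFinP; exact: measurable_prod_set.
  - apply: filterS psi_phi => w psi_phi _; congr _%:E.
    by apply: eq_bigr => j _; rewrite psi_phi.
(* The multilinear interpolation of [G] at [psi]: a measurable function that dominates [G] of [phi]
   almost everywhere. *)
pose h w := (\sum_(S : {set 'I_n})
  (G (\row_k sign R S k))%:E * (\prod_k ((1 + sign R S k * psi k w) / 2))%:E)%E.
have mweight (S : {set 'I_n}) : measurable_fun [set: Omega]
    (fun w => (\prod_k ((1 + sign R S k * psi k w) / 2))%:E).
  apply/measurable_EFinP; apply: measurable_prod => k _.
  apply: measurable_funM => //; apply: measurable_funD => //.
  exact: measurable_funM.
have h_ge0 S w : (0 <= (G (\row_k sign R S k))%:E *
    (\prod_k ((1 + sign R S k * psi k w) / 2))%:E)%E.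
  by rewrite mule_ge0// lee_fin.
rewrite EG multE -EFinD -EFinM unlock; apply: (@le_trans _ _ (\int[P]_w h w)%E).
  apply: le_integral_dominating => [w|||].
  - by rewrite lee_fin.
  - apply: emeasurable_sum => S; exact: measurable_funeM.
  - by move=> w; apply: sume_ge0.
  - apply: filterS psi_phi => w psi_phi.
    rewrite /h; under eq_bigr do rewrite -EFinM.
    rewrite sumEFin lee_fin.
    have -> : \row_k phi k w = \row_k psi k w.
      by apply/rowP => k; rewrite !mxE psi_phi.
    apply: le_trans (separately_convex_le_vertices G_convex _) _ => [k|].
      by rewrite mxE.
    apply: ler_sum => S _; rewrite mulrC.
    rewrite (eq_bigr (fun k => (1 + sign R S k * psi k w) / 2))// => k _.
    by rewrite mxE.
rewrite /h ge0_integral_sum//; last by move=> S; exact: measurable_funeM.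
rewrite mulr_sumr -sumEFin; apply: lee_sum => S _.
rewrite ge0_integralZl//; [|by move=> w _; rewrite lee_fin|by rewrite lee_fin].
(* The comparison is made vertex by vertex: [cp] is multiplied by the nonnegative value of [G]. *)
rewrite weightE -EFinM lee_fin [leRHS]mulrA [leRHS]mulrC.
by apply: ler_wpM2l => //; exact: cp.
Qed.
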